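(* Let $\mathbf{A}$ be a De Morgan monoid that is finitely subdirectly irreducible and not idempotent. Then $$A=(\neg(f^2)]\;\cup\;[\neg(f^2),f^2]\;\cup\;[f^2),$$ where the interval $[\neg(f^2),f^2]=\{x\in A:\neg(f^2)\leqslant x\leqslant f^2\}$ is the universe of a subalgebra of $\mathbf{A}$, and the sets $(\neg(f^2)]=\{x\in A: x\leqslant \neg(f^2)\}$ and $[f^2)=\{x\in A: f^2\leqslant x\}$ are chains (totally ordered subsets) consisting of idempotent elements.
   Context: An involutive (commutative) residuated lattice (IRL) is an algebra $\mathbf{A}=\langle A;\cdot,\wedge,\vee,\neg,e\rangle$ such that $\langle A;\cdot,e\rangle$ is a commutative monoid, $\langle A;\wedge,\vee\rangle$ is a lattice with order $\leqslant$, $\neg\neg x=x$, and $x\cdot y\leqslant z \iff \neg z\cdot y\leqslant \neg x$ for all $x,y,z$. One writes $f:=\neg e$, $x\to y:=\neg(x\cdot\neg y)$, $x^2:=x\cdot x$. It is square-increasing if $x\leqslant x^2$ for all $x$. A De Morgan monoid is a square-increasing IRL whose lattice reduct is distributive. An element $a$ is idempotent if $a^2=a$; an algebra is idempotent if all its elements are. An algebra is finitely subdirectly irreducible (FSI) if its identity relation is meet-irreducible in its congruence lattice (trivial algebras count as FSI). A subalgebra is taken in the full signature $\cdot,\wedge,\vee,\neg,e$. *)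

(* Defs.v *)
From HB Require Import structures.
From mathcomp Require Import all_boot all_order interval.
From mathcomp Require Import boolp classical_sets set_interval.
From Stdlib Require Import RelationClasses.

Set Implicit Arguments.
Unset Strict Implicit.
Unset Printing Implicit Defensive.

Import Order.TTheory.

Local Open Scope classical_set_scope.
Local Open Scope order_scope.
Local Open Scope group_scope.

Reserved Notation "\neg x" (at level 35, right associativity).

HB.mixin Record isIRL (d : Order.disp_t) A
    of Order.Lattice d A & monoid.Monoid A := {
  irl_neg : A -> A;
  irl_mulC : commutative (@mul A);
  irl_negK : involutive irl_neg;
  irl_residuation : forall x y z : A,
    x * y <= z <-> irl_neg z * y <= irl_neg x
}.

#[short(type="irlType")]
HB.structure Definition IRL (d : Order.disp_t) :=
  {A of isIRL d A & Order.Lattice d A & monoid.Monoid A}.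

Notation "\neg x" := (irl_neg x) : group_scope.

HB.mixin Record isSquareIncreasing (d : Order.disp_t) A of IRL d A := {
  square_increasing : forall x : A, x <= x ^+ 2
}.

#[short(type="deMorganMonoidType")]
HB.structure Definition DeMorganMonoid (d : Order.disp_t) :=
  {A of isSquareIncreasing d A & IRL d A & Order.DistrLattice d A}.

Section IRLNotions.
Context {d : Order.disp_t} {A : irlType d}.

Definition irl_f : A := \neg 1.

Definition idempotent_elt (x : A) : Prop := x ^+ 2 = x.

Definition subuniverse (B : set A) : Prop :=
  [/\ B 1,
      forall x, B x -> B (\neg x)
    & forall x y, B x -> B y -> [/\ B (x * y), B (x `&` y)%O & B (x `|` y)%O]].

Definition congruence (R : set (A * A)) : Prop :=
  [/\ Equivalence (fun x y => R (x, y)),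
      forall x y, R (x, y) -> R (\neg x, \neg y)
    & forall x y z t, R (x, y) -> R (z, t) ->
        [/\ R (x * z, y * t),
            R ((x `&` z)%O, (y `&` t)%O)
          & R ((x `|` z)%O, (y `|` t)%O)]].

End IRLNotions.

Definition idempotent_irl d (A : irlType d) : Prop :=
  forall x : A, idempotent_elt x.

Definition id_rel (T : Type) : set (T * T) := [set p | p.1 = p.2].

Arguments id_rel T : clear implicits.

(* Meets in the congruence lattice are intersections; meet-irreducibility does
   not exclude the top element, so trivial algebras are FSI. *)
Definition fsi d (A : irlType d) : Prop :=
  forall R S : set (A * A), congruence R -> congruence S ->
    id_rel A = (R `&` S)%classic -> id_rel A = R \/ id_rel A = S.

Definition chain d (A : porderType d) (C : set A) : Prop :=
  total_on C (fun x y => (x <= y)%O).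

(* Main.v *)
(** The unit [1] is join-prime in a finitely subdirectly irreducible De Morgan
    monoid: if [1] is the join of [a <= 1] and [b <= 1], the congruences
    "[c x <= y] and [c y <= x]" for [c = a] and [c = b] intersect in the identity.
    To get [x <= y] or [y <= x] it is therefore enough that
    [(x \neg y) (y \neg x) <= f], because the meet of two elements lies below
    their product and [x \neg y <= f] means [x <= y].

    Put [t := \neg (f ^+ 2)].  Then [f t <= 1] is idempotent, as is [t], whence
    [f^2 t = f t <= t]; so [f^3 = f^2], and [x \neg x <= t] whenever [f^2 <= x].
    These two bounds give the comparability of every element with [f^2] and of
    the elements above [f^2] with each other, and the latter are idempotent
    because [x^2 \neg x = (x \neg x)^2 <= f].  Involution transfers this to the
    elements below [t].  Finally [1 <= f^2], for otherwise [f^2 <= f], i.e.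
    [f <= 1], which forces idempotence. *)
Require Import Defs.
From HB Require Import structures.
From mathcomp Require Import all_boot all_order interval.
From mathcomp Require Import boolp classical_sets set_interval.

Set Implicit Arguments.
Unset Strict Implicit.
Unset Printing Implicit Defensive.

Import Order.TTheory.

Local Open Scope classical_set_scope.
Local Open Scope order_scope.
Local Open Scope group_scope.

Section IRLTheory.
Context {d : Order.disp_t} {A : irlType d}.
Implicit Types x y z c : A.

Lemma irl_mulACA x y z c : (x * y) * (z * c) = (x * z) * (y * c).
Proof. by rewrite !mulgA -(mulgA x y) (irl_mulC y) !mulgA. Qed.

Lemma neg_le2 x y : (\neg y <= \neg x) = (x <= y).
Proof.
have neg_anti z c : z <= c -> \neg c <= \neg z.
  by move=> zc; have := (irl_residuation z 1 c).1; rewrite !mulg1; apply.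
by apply/idP/idP => /neg_anti //; rewrite !irl_negK.
Qed.

Lemma neg_leC x y : (\neg x <= y) = (\neg y <= x).
Proof. by rewrite -{1}[y]irl_negK neg_le2. Qed.

Lemma le_negC x y : (x <= \neg y) = (y <= \neg x).
Proof. by rewrite -{1}[x]irl_negK neg_le2. Qed.

(** [\neg (x * \neg z)] is the residual of [z] by [x]. *)
Lemma mul_le_res x y z : (x * y <= z) = (y <= \neg (x * \neg z)).
Proof.
rewrite le_negC [x * y]irl_mulC [x * _]irl_mulC.
by apply/idP/idP => [/irl_residuation|le_neg] //; apply/irl_residuation.
Qed.

Lemma mul_le_f x y : (x * y <= irl_f) = (x <= \neg y).
Proof. by rewrite irl_mulC mul_le_res irl_negK mulg1. Qed.

Lemma mul_neg_le_f x y : (x * \neg y <= irl_f) = (x <= y).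
Proof. by rewrite mul_le_f irl_negK. Qed.

Lemma mul_le2l x y z : y <= z -> x * y <= x * z.
Proof. by move=> yz; rewrite mul_le_res (le_trans yz) // -mul_le_res. Qed.

Lemma mul_le2 x y z c : x <= y -> z <= c -> x * z <= y * c.
Proof.
move=> xy zc; apply: le_trans (mul_le2l _ zc) _.
by rewrite ![_ * c]irl_mulC mul_le2l.
Qed.

Lemma mul_join_le x y z c :
  (x * (y `|` z)%O <= c) = (x * y <= c) && (x * z <= c).
Proof. by rewrite !(mul_le_res x) leUx. Qed.

Lemma neg_meet x y : \neg (x `&` y)%O = (\neg x `|` \neg y)%O.
Proof.
apply/le_anti/andP; split.
  by rewrite neg_leC lexI -2!(neg_leC _ (_ `|` _)%O) leUl leUr.
by rewrite leUx !neg_le2 leIl leIr.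
Qed.

(** Says that [c] lies below both residuals between the two components: the relation of the
    deductive filter of elements above [c]. *)
Definition below_unit_rel c : set (A * A) :=
  [set p | c * p.1 <= p.2 /\ c * p.2 <= p.1].

Lemma below_unit_rel_congruence c : c <= 1 -> c <= c * c ->
  congruence (below_unit_rel c).
Proof.
move=> c1 cc.
(* [c <= c * c] supplies one factor [c] for each hypothesis, here and in [mu]. *)
have tr x y z : c * x <= y -> c * y <= z -> c * x <= z.
  move=> xy; apply: le_trans.
  apply: le_trans (mul_le2l c xy); rewrite mulgA; exact: mul_le2.
have ng x y : c * x <= y -> c * \neg y <= \neg x.
  by rewrite [c * _]irl_mulC => /irl_residuation; rewrite irl_mulC.
have mu x y z w : c * x <= y -> c * z <= w -> c * (x * z) <= y * w.
  move=> xy zw; apply: le_trans (mul_le2 xy zw).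
  by rewrite irl_mulACA; apply: mul_le2.
have me x y z w : c * x <= y -> c * z <= w -> c * (x `&` z)%O <= (y `&` w)%O.
  move=> xy zw; rewrite lexI; apply/andP; split.
    by apply: le_trans xy; apply: mul_le2l; apply: leIl.
  by apply: le_trans zw; apply: mul_le2l; apply: leIr.
have jo x y z w : c * x <= y -> c * z <= w -> c * (x `|` z)%O <= (y `|` w)%O.
  move=> xy zw; rewrite mul_join_le.
  by rewrite (le_trans xy) ?leUl // (le_trans zw) ?leUr.
split.
- split.
  + by move=> x; split=> /=; rewrite -[leRHS]mul1g mul_le2.
  + by move=> x y [].
  + by move=> x y z [/= xy yx] [/= yz zy]; split=> /=; [exact: tr yz|exact: tr yx].
- by move=> x y [/= xy yx]; split; apply: ng.
move=> x y z w [/= xy yx] [/= zw wz].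
by split; split; (exact: mu || exact: me || exact: jo).
Qed.

End IRLTheory.

Section DeMorganMonoidTheory.
Context {d : Order.disp_t} {A : deMorganMonoidType d}.
Implicit Types x y : A.

Lemma le_sqr x : x <= x * x.
Proof. exact: square_increasing. Qed.

Lemma meet_le_mul x y : (x `&` y)%O <= x * y.
Proof. by apply: le_trans (le_sqr _) _; apply: mul_le2; rewrite ?leIl ?leIr. Qed.

Lemma sqr_below_unit x : x <= 1 -> x * x = x.
Proof.
move=> x1; apply/le_anti; rewrite le_sqr andbT.
by rewrite -[leRHS]mulg1 mul_le2l.
Qed.

Lemma fsi_unit_join_prime x y :
  fsi A -> 1 <= (x `|` y)%O -> 1 <= x \/ 1 <= y.
Proof.
move=> fsiA; pose a := (x `&` 1)%O; pose b := (y `&` 1)%O => xy1.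
have a1 : a <= 1 by apply: leIr.
have b1 : b <= 1 by apply: leIr.
(* Distributivity of the lattice enters here. *)
have ab : 1 <= (a `|` b)%O by rewrite /a /b -meetUl lexI xy1 /=.
(* The congruence of [c] always relates [c] to [1]. *)
have eq_unit (c : A) : c <= 1 -> id_rel A = below_unit_rel c -> c = 1.
  move=> c1 idE; have : below_unit_rel c (c, 1).
    by split=> /=; rewrite ?mulg1 // sqr_below_unit.
  by rewrite -idE.
have cong (c : A) : c <= 1 -> congruence (below_unit_rel c).
  by move=> c1; apply: below_unit_rel_congruence => //; apply: le_sqr.
have le_of (u v : A) : a * u <= v -> b * u <= v -> u <= v.
  move=> au bu; rewrite -[leLHS]mulg1; apply: le_trans (mul_le2l _ ab) _.
  by rewrite mul_join_le (irl_mulC u a) (irl_mulC u b) au bu.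
have cap : id_rel A = (below_unit_rel a `&` below_unit_rel b)%classic.
  apply/seteqP; split=> -[u v] /=.
    rewrite /id_rel /= => ->.
    by do 2!split=> /=; rewrite -[leRHS]mul1g mul_le2.
  move=> [[/= au av] [/= bu bv]]; rewrite /id_rel /=.
  by apply/le_anti/andP; split; apply: le_of.
case: (fsiA _ _ (cong _ a1) (cong _ b1) cap) => /eq_unit E; [left|right].
  by rewrite -(E a1) leIl.
by rewrite -(E b1) leIl.
Qed.

Lemma fsi_le_total x y : fsi A ->
  (x * \neg y) * (y * \neg x) <= irl_f -> x <= y \/ y <= x.
Proof.
move=> fsiA le_f; rewrite -(mul_neg_le_f x y) -(mul_neg_le_f y x) /irl_f.
rewrite 2!(le_negC _ 1); apply: fsi_unit_join_prime => //.
by rewrite -neg_meet le_negC (le_trans (meet_le_mul _ _)).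
Qed.

(** The meet of [x] and [\neg x] lies below [\neg x * x <= irl_f], so [1] lies below their join. *)
Lemma fsi_unit_le_or_le_f x : fsi A -> 1 <= x \/ x <= irl_f.
Proof.
move=> fsiA; rewrite /irl_f le_negC; apply: fsi_unit_join_prime => //.
rewrite -{1}[x]irl_negK -neg_meet le_negC (le_trans (meet_le_mul _ _)) //.
by rewrite irl_mulC mul_neg_le_f.
Qed.

Local Notation f := (irl_f : A).
Local Notation t := (\neg (f * f)).

Lemma sqr_of_mul_neg_le_unit x : 1 <= x -> x * \neg x <= 1 -> x * x = x.
Proof.
move=> x1 u1; apply/le_anti; rewrite le_sqr andbT -mul_neg_le_f.
(* With this, both [\neg x] and [x * \neg x] lie below [1] and are therefore idempotent. *)
have y1 : \neg x <= 1.
  by apply: le_trans u1; rewrite -[leLHS]mul1g mul_le2.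
by rewrite -(sqr_below_unit y1) irl_mulACA (sqr_below_unit u1) mul_neg_le_f.
Qed.

Lemma neg_f2_le_unit : t <= 1.
Proof. by rewrite neg_leC le_sqr. Qed.

Lemma mul_f_neg_f2_le_unit : f * t <= 1.
Proof.
rewrite -[leRHS]irl_negK -mul_le_f -/irl_f irl_mulC mulgA.
by rewrite mul_neg_le_f.
Qed.

Lemma mul_f2_neg_f2 : (f * f) * t = f * t.
Proof.
rewrite -[RHS](sqr_below_unit mul_f_neg_f2_le_unit) irl_mulACA.
by rewrite (sqr_below_unit neg_f2_le_unit).
Qed.

(** The claim amounts to [f^3 t <= f], and [f^3 t = f^2 t <= f]. *)
Lemma mul_f_neg_f2_le : f * t <= t.
Proof.
by rewrite -mul_le_f irl_mulC -mulgA [f * (f * t)]mulgA !mul_f2_neg_f2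
  mulgA mul_neg_le_f.
Qed.

Lemma mul_neg_le_neg_f2 x : f * f <= x -> x * \neg x <= t.
Proof.
move=> f2x; have yt : \neg x <= t by rewrite neg_le2.
have y1 := le_trans yt neg_f2_le_unit.
(* Doubling the idempotent [\neg x] gives [(x * \neg x) * \neg x <= f * t]. *)
rewrite -(sqr_below_unit y1) mulgA; apply: le_trans mul_f_neg_f2_le.
by apply: mul_le2 yt; rewrite mul_neg_le_f.
Qed.

Lemma f2_idem : (f * f) * (f * f) = f * f.
Proof.
apply/le_anti; rewrite le_sqr andbT -mul_neg_le_f -mulgA mul_f2_neg_f2 -mulgA.
by rewrite [f * (f * t)]mulgA mul_f2_neg_f2 mulgA mul_neg_le_f.
Qed.

Lemma fsi_unit_le_f2 : fsi A -> ~ idempotent_irl A -> 1 <= f * f.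
Proof.
move=> fsiA nidA; case: (fsi_unit_le_or_le_f (f * f) fsiA) => // f2f.
have f1 : f <= 1 by rewrite -[leRHS]irl_negK -mul_le_f.
(* Since [f <= 1], either [1 <= x] and [x * \neg x <= f <= 1], or [x <= f <= 1]. *)
case: nidA => x; rewrite /idempotent_elt expg2.
case: (fsi_unit_le_or_le_f x fsiA) => [x1|xf].
  by apply: sqr_of_mul_neg_le_unit x1 (le_trans _ f1); rewrite mul_neg_le_f.
exact: sqr_below_unit (le_trans xf f1).
Qed.

End DeMorganMonoidTheory.

Theorem theorem5p17 (d : Order.disp_t) (A : deMorganMonoidType d)
    (f2 := irl_f ^+ 2 : A) :
  fsi A -> ~ idempotent_irl A ->
  [/\ [set: A] = (`]-oo, \neg f2] `|` `[\neg f2, f2] `|` `[f2, +oo[)%classic,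
      subuniverse (`[\neg f2, f2]%classic : set A),
      chain (`]-oo, \neg f2]%classic : set A)
        /\ (forall x : A, `]-oo, \neg f2]%classic x -> idempotent_elt x)
    & chain (`[f2, +oo[%classic : set A)
        /\ (forall x : A, `[f2, +oo[%classic x -> idempotent_elt x)].
Proof.
move=> fsiA nidA; have f2E : f2 = irl_f * irl_f by rewrite /f2 expg2.
have e_f2 := fsi_unit_le_f2 fsiA nidA; rewrite {}/f2 in f2E *.
rewrite f2E {f2E}; set F := irl_f * irl_f in e_f2 *; set t := \neg F.
have t1 : t <= 1 := neg_f2_le_unit.
have le_t (x : A) : (x <= t) = (F <= \neg x) by rewrite le_negC.
have chainF (x y : A) : F <= x -> F <= y -> x <= y \/ y <= x.
  move=> Fx Fy; apply: fsi_le_total => //.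
  (* Regroup as [(x * \neg x) * (y * \neg y)], bounded by [irl_f * 1]. *)
  rewrite irl_mulACA [\neg y * _]irl_mulC irl_mulACA -[leRHS]mulg1.
  apply: mul_le2; first by rewrite mul_neg_le_f.
  exact: le_trans (mul_neg_le_neg_f2 Fy) t1.
have cmpF (x : A) : F <= x \/ x <= F.
  apply: fsi_le_total => //.
  (* The same regrouping; only [F * \neg F] has to lie below [1], so [x] is arbitrary. *)
  rewrite irl_mulACA [\neg x * _]irl_mulC irl_mulACA irl_mulC -[leRHS]mulg1.
  apply: mul_le2; first by rewrite mul_neg_le_f.
  exact: le_trans (mul_neg_le_neg_f2 (lexx _)) t1.
split.
- apply/seteqP; split=> // x _ /=; rewrite !in_itv /= andbT.
  case: (cmpF x) => [|xF]; [by right|left].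
  case: (cmpF (\neg x)); first by rewrite -le_t; left.
  by rewrite neg_leC xF => ->; right.
- split=> [|x|x y] /=; rewrite !in_itv /=.
  + by rewrite t1.
  + by move=> /andP[tx xF]; rewrite neg_le2 xF neg_leC.
  move=> /andP[tx xF] /andP[ty yF]; split.
  (* Both endpoints are idempotent: [t = t * t <= x * y <= F * F = F]. *)
  * by rewrite -{1}(sqr_below_unit t1) -(f2_idem : F * F = F) !mul_le2.
  * by rewrite lexI tx ty leIxl.
  * by rewrite leUx xF yF lexUl.
- split=> [x y|x] /=; rewrite !in_itv /=.
    by rewrite !le_t => Fx /(chainF _ _ Fx); rewrite !neg_le2 => -[]; [right|left].
  (* Idempotence below [t] comes directly from [t <= 1]. *)
  by move=> /le_trans/(_ t1)/sqr_below_unit xx; rewrite /idempotent_elt expg2.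
split=> [x y|x] /=; rewrite !in_itv /= !andbT; first exact: chainF.
move=> Fx; rewrite /idempotent_elt expg2; apply: sqr_of_mul_neg_le_unit.
  exact: le_trans Fx.
exact: le_trans (mul_neg_le_neg_f2 Fx) t1.
Qed.
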